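(* Let $K_{ff}$ be invertible, $C=K_{ff}^{-1}$, let $P$ be a set of $p$ free degrees of freedom, and suppose $C_{\mu\mu}\ne0$ for every $\mu\in P$. Then for every $\mu\ne\nu$ in $P$, $$D_{\nu\mu}=\frac{C_{\nu\mu}}{C_{\mu\mu}}.$$ Whenever $C=C^{T}$, for all $\mu,\nu,\rho\in P$, $$D_{\nu\mu}C_{\mu\mu}=D_{\mu\nu}C_{\nu\nu}=C_{\mu\nu},\qquad D_{\nu\mu}D_{\rho\nu}D_{\mu\rho}=D_{\mu\nu}D_{\nu\rho}D_{\rho\mu},$$ both sides of the second identity being $C_{\nu\mu}C_{\rho\nu}C_{\mu\rho}/(C_{\mu\mu}C_{\nu\nu}C_{\rho\rho})$. If in addition the network is passive, so that $C\succ0$, then the diagonal entries $C_{\mu\mu}$ are positive and $\operatorname{sign}D_{\nu\mu}=\operatorname{sign}D_{\mu\nu}$ and, for $\mu\neq\nu$, $D_{\nu\mu}D_{\mu\nu}<1$. The diagonal of $D=(D_{\nu\mu})_{\nu,\mu\in P}$ is identically one. For $p\ge2$ and whenever $C=C^{T}$, $$\operatorname{rank}\frac{\partial D}{\partial k}\;\le\;\min\Bigl(n_b,\ \tfrac12(p-1)(p+2)\Bigr),$$ where $\tfrac12(p-1)(p+2)=p(p-1)-\tfrac12(p-1)(p-2)$, i.e. the rank ceiling lies $(p-1)(p-2)/2$ below the number $p(p-1)$ of off-diagonal entries.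
   Context: Network: $N$ point nodes at positions $x_i\in\mathbb{R}^2$ are joined by $n_b$ bonds. For a bond $b=(i,j)$ of length $L_b=|x_j-x_i|>0$ let $\hat n_b=(x_j-x_i)/L_b$ and let $\hat t_b$ be $\hat n_b$ rotated by $+90^\circ$. The vector $q_b\in\mathbb{R}^{2N}$ carries $-\hat n_b$ at node $i$, $+\hat n_b$ at node $j$, zeros elsewhere; $s_b$ is the same with $\hat t_b$. For stiffnesses $k=(k_b)$, $k_b>0$, and odd couplings $a=(a_b)\in\mathbb{R}^{n_b}$, $K=\sum_b(k_bq_b+a_bs_b)q_b^{T}$. Three degrees of freedom are pinned to remove the planar rigid-body modes and $K_{ff}$ is the restriction of $K$ to the remaining $n_{\mathrm{free}}=2N-3$ free ones. Passive means $a\equiv0$ and $K_{ff}\succ0$. Derivatives in $k$ are taken at fixed $a$. Transmission: for $\mu,\nu\in P$, $D_{\nu\mu}$ is the displacement $u_\nu$ at $\nu$ in the state $u$ on the free degrees of freedom with $u_\mu=1$ imposed and every other free degree of freedom in equilibrium, i.e. $(K_{ff}u)_i=0$ for all free $i\ne\mu$ (the condition $C_{\mu\mu}\neq 0$ is equivalent to this problem having a unique solution). *)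

(* Defs.v *)
From mathcomp Require Import all_boot all_order all_algebra.
From mathcomp Require Import all_classical all_reals topology normedtype derive.

Set Implicit Arguments.
Unset Strict Implicit.
Unset Printing Implicit Defensive.
Import Order.TTheory GRing.Theory Num.Theory.
Import numFieldNormedType.Exports.

Local Open Scope ring_scope.
Local Open Scope classical_set_scope.

(* The norm `|v| that MathComp-Analysis puts on matrices is the sup norm, hence
   a separate Euclidean length. *)
Definition eucl (R : realType) (v : 'rV[R]_2) : R :=
  Num.sqrt (\sum_(d < 2) v 0 d ^+ 2).

Definition rot90 (R : realType) (v : 'rV[R]_2) : 'rV[R]_2 :=
  \row_(d < 2) (if d == 0 then - v 0 1 else v 0 0).

(* A planar displacement field, one row per node, is flattened by mxvec; a
   degree of freedom is thus an index in 'I_(N * 2). *)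
Definition rigid_mode (R : realType) (N : nat) (pos : 'I_N -> 'rV[R]_2)
    (v : 'rV[R]_2) (w : R) : 'M[R]_(N, 2) :=
  \matrix_(m < N) (v + w *: rot90 (pos m)).

Record network (R : realType) (N nb : nat) := Network {
  pos : 'I_N -> 'rV[R]_2;
  src : 'I_nb -> 'I_N;
  tgt : 'I_nb -> 'I_N;
  bond_length_gt0 : forall b, 0 < eucl (pos (tgt b) - pos (src b));
  pinned : {set 'I_(N * 2)};
  card_pinned : #|pinned| = 3;
  pinned_rigid : forall (v : 'rV[R]_2) (w : R),
    (forall d, d \in pinned -> mxvec (rigid_mode pos v w) 0 d = 0) ->
    rigid_mode pos v w = 0
}.

Section Network.
Variables (R : realType) (N nb : nat) (net : network R N nb).

Definition bond_length (b : 'I_nb) : R :=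
  eucl (pos net (tgt net b) - pos net (src net b)).

Definition bond_dir (b : 'I_nb) : 'rV[R]_2 :=
  (bond_length b)^-1 *: (pos net (tgt net b) - pos net (src net b)).

Definition bond_vec (b : 'I_nb) (v : 'rV[R]_2) : 'cV[R]_(N * 2) :=
  (mxvec (\matrix_(m < N)
    (if m == src net b then - v else if m == tgt net b then v else 0)))^T.

Definition qvec (b : 'I_nb) : 'cV[R]_(N * 2) := bond_vec b (bond_dir b).

Definition svec (b : 'I_nb) : 'cV[R]_(N * 2) := bond_vec b (rot90 (bond_dir b)).

Definition stiffness (k a : 'rV[R]_nb) : 'M[R]_(N * 2) :=
  \sum_(b < nb) (k 0 b *: qvec b + a 0 b *: svec b) *m (qvec b)^T.

Definition free_dofs : {set 'I_(N * 2)} := (~: pinned net)%SET.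

(* Equal to 2N - 3, see nfreeE. *)
Definition nfree : nat := #|free_dofs|.

Definition free_dof (i : 'I_nfree) : 'I_(N * 2) := enum_val i.

Definition Kff (k a : 'rV[R]_nb) : 'M[R]_nfree :=
  mxsub free_dof free_dof (stiffness k a).

Lemma nfreeE : nfree = (2 * N - 3)%N.
Proof. by rewrite /nfree /free_dofs cardsCs finset.setCK card_pinned card_ord mulnC. Qed.

End Network.

Definition posdefmx (R : realType) (n : nat) (A : 'M[R]_n) : Prop :=
  A^T = A /\ forall v : 'cV[R]_n, v != 0 -> 0 < (v^T *m A *m v) 0 0.

Definition passive (R : realType) (N nb : nat) (net : network R N nb)
    (k a : 'rV[R]_nb) : Prop :=
  a = 0 /\ posdefmx (Kff net k a).

Definition transmission_state (R : realType) (n : nat) (A : 'M[R]_n)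
    (mu : 'I_n) (u : 'cV[R]_n) : Prop :=
  u mu 0 = 1 /\ forall i, i != mu -> (A *m u) i 0 = 0.

(* The displacement at nu in the transmission state driven at mu, read off a
   state picked by choice; the state is unique exactly when C_mumu != 0, see
   transmission_state_uniqueP. *)
Definition transmission (R : realType) (n : nat) (A : 'M[R]_n)
    (nu mu : 'I_n) : R :=
  xget 0 [set u | transmission_state A mu u] nu 0.

Definition transmission_mx (R : realType) (n : nat) (A : 'M[R]_n)
    (P : {set 'I_n}) : 'M[R]_#|P| :=
  \matrix_(i, j) transmission A (enum_val i) (enum_val j).

(* The map k |-> D at fixed a, flattened to a row vector so that its derivative
   is the Jacobian matrix 'J of the library (one row per bond, one column per
   entry of D). *)
Definition transmission_map (R : realType) (N nb : nat) (net : network R N nb)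
    (P : {set 'I_(nfree net)}) (a : 'rV[R]_nb) :
    'rV[R]_nb -> 'rV[R]_(#|P| * #|P|) :=
  fun k => mxvec (transmission_mx (Kff net k a) P).

Lemma transmission_state_uniqueP (R : realType) (n : nat) (A : 'M[R]_n)
    (mu : 'I_n) : A \in unitmx ->
  (exists! u, transmission_state A mu u) <-> invmx A mu mu != 0.
Proof.
move=> uA.
have stateE u : transmission_state A mu u ->
    exists2 c, u = c *: col mu (invmx A) & c * invmx A mu mu = 1.
  move=> [u1 ueq]; pose c := (A *m u) mu 0.
  have Au : A *m u = c *: delta_mx mu 0.
    apply/matrixP => i j; rewrite ord1 !mxE eqxx andbT.
    have [->|ne] := eqVneq i mu; first by rewrite mulr1 /c mxE.
    by rewrite mulr0; have := ueq i ne; rewrite mxE.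
  have uE : u = c *: col mu (invmx A).
    by rewrite colE scalemxAr -Au mulKmx.
  by exists c => //; rewrite -u1 uE !mxE.
split=> [[u [+ _]]|C0].
  move=> /stateE [c _ c1]; apply/eqP => C0.
  by move: c1; rewrite C0 mulr0 => /eqP; rewrite eq_sym oner_eq0.
exists ((invmx A mu mu)^-1 *: col mu (invmx A)); split.
  split=> [|i ne]; first by rewrite !mxE mulVf.
  by rewrite -scalemxAr colE mulKVmx // !mxE (negbTE ne) mulr0.
move=> u /stateE [c -> c1]; congr (_ *: _).
by apply: (mulIf C0); rewrite c1 mulVf.
Qed.

(* Main.v *)
(* A transmission state driven at mu is the mu-th column of C normalised at mu,
   so D_(nu mu) = C_(nu mu) / C_(mu mu), which is also the ratio of the entries
   (nu, mu) and (mu, mu) of the adjugate of K_ff, a polynomial in k.  The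
   antisymmetric part of K_ff does not involve k, hence if C is symmetric at one
   k, the adjugate is symmetric at every k.  Every directional derivative of D is
   therefore the image of a symmetric p x p matrix (the derivative of the
   adjugate) under one fixed linear map, and this map kills the adjugate itself
   since D is invariant under rescaling of C.  So the rank is at most
   p (p + 1) / 2 - 1 = (p - 1) (p + 2) / 2. *)
Require Import Defs.
From HB Require Import structures.
From mathcomp Require Import all_boot all_order all_algebra.
From mathcomp Require Import all_classical all_reals topology normedtype landau derive.
From mathcomp Require Import ring zify.

Set Implicit Arguments.
Unset Strict Implicit.
Unset Printing Implicit Defensive.
Import Order.TTheory GRing.Theory Num.Theory.
Import numFieldNormedType.Exports.
Local Open Scope ring_scope.

Lemma rank_ceilingE (p : nat) : (1 < p)%N ->
  (((p - 1) * (p + 2)) %/ 2 = 'C(p.+1, 2).-1)%N /\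
  (((p - 1) * (p + 2)) %/ 2 = p * (p - 1) - ((p - 1) * (p - 2)) %/ 2)%N.
Proof.
case: p => [|[|q]] // _.
(* With p = q + 2, these write (p - 1)(p - 2) and p (p + 1) as doubled binomials, so every truncated
   halving is exact. *)
have := mul_bin_diag q.+1 1; have := mul_bin_diag q.+3 1; rewrite /= !bin1.
by lia.
Qed.

(** * Dimension count for linear images of symmetric matrices *)

Section SymmetricImage.
Lemma card_ord_pair_le (p : nat) :
  #|[set x : 'I_p * 'I_p | x.1 <= x.2]%N| = 'C(p.+1, 2).
Proof.
rewrite -sum1dep_card.
(* Counting by the larger component [j], which admits [j.+1] smaller or equal ones. *)
transitivity (\sum_(j < p) \sum_(i < p | (i < j.+1)%N) 1)%N.
  by rewrite (exchange_big_dep xpredT) //= pair_big_dep; apply: eq_bigl.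
rewrite (eq_bigr (fun j : 'I_p => j.+1)) => [|j _]; last first.
  by rewrite (big_ord_narrow (ltn_ord j)) sum_nat_const card_ord muln1.
by rewrite -(big_mkord xpredT succn) -bin2_sum [RHS]big_nat_recl //= add0n.
Qed.

Variables (F : fieldType) (p q m : nat).

(** The standard basis of the symmetric matrices, for pairs with [x.1 <= x.2]; the boolean factor
    keeps a diagonal unit from being counted twice. *)
Definition sym_delta (x : 'I_p * 'I_p) : 'M[F]_p :=
  delta_mx x.1 x.2 + (x.1 != x.2)%:R *: delta_mx x.2 x.1.

Lemma sym_mx_sum_delta (E : 'M[F]_p) : E^T = E ->
  E = \sum_(x in [set x : 'I_p * 'I_p | x.1 <= x.2]%N) E x.1 x.2 *: sym_delta x.
Proof.
move=> symE; apply/matrixP => i j; rewrite summxE.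
have Eji : E j i = E i j by rewrite -[in LHS]symE mxE.
wlog le_ij : i j Eji / (i <= j)%N.
  move=> wl; have [|/ltnW] := leqP i j; first exact: (wl i j Eji).
  move=> /(wl j i (esym Eji)); rewrite Eji => ->; apply: eq_bigr => -[u v] _.
  rewrite !mxE /=; have [->|_] := eqVneq u v; first by rewrite !mul0r andbC.
  by rewrite !mul1r addrC andbC [in X in _ + X]andbC.
rewrite (bigD1 (i, j)) ?inE //= big1 ?addr0 => [|[i' j']].
  rewrite !mxE !eqxx /=; have [->|_] := eqVneq i j; first by rewrite mul0r addr0 mulr1.
  by rewrite mulr0 addr0 mulr1.
rewrite inE /= xpair_eqE => /andP[le_ij' ne].
rewrite !mxE /= eq_sym [j == _]eq_sym (negbTE ne) add0r.
have [/= <-|ne'] := eqVneq i' j'; first by rewrite mul0r mulr0.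
case: eqVneq => [e1|]; last by rewrite /= !mulr0.
case: eqVneq => [e2|]; last by rewrite /= !mulr0.
(* A transposed unit at (i, j) gives j' = i <= j = i' <= j', hence i' = j', against [ne']. *)
by case/eqP: ne'; apply/val_inj/eqP; rewrite eqn_leq le_ij' -e1 -e2 le_ij.
Qed.

(* The symmetric matrices have dimension p (p + 1) / 2, and the kernel of f
   takes away the line spanned by M. *)
Lemma rank_sym_image (f : {linear 'M[F]_p -> 'rV[F]_q}) (M : 'M[F]_p)
    (i0 : 'I_p) (J : 'M[F]_(m, q)) :
  M^T = M -> M i0 i0 != 0 -> f M = 0 ->
  (forall b, exists2 E : 'M[F]_p, E^T = E & row b J = f E) ->
  (\rank J <= 'C(p.+1, 2).-1)%N.
Proof.
move=> symM M0 fM imJ.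
set S := [set x : 'I_p * 'I_p | x.1 <= x.2]%N.
have S0 : (i0, i0) \in S by rewrite inE.
pose B := \matrix_(s < #|(S :\ (i0, i0))%SET|) f (sym_delta (enum_val s)).
have -> : 'C(p.+1, 2).-1 = #|(S :\ (i0, i0))%SET|.
  by rewrite -card_ord_pair_le (cardsD1 (i0, i0)) S0.
apply: leq_trans (rank_leq_row B); apply: mxrankS; apply/row_subP => b.
have [E symE ->] := imJ b.
(* Moving along the kernel direction [M] clears the entry (i0, i0), so one basis element drops out
   of the expansion. *)
pose E' := E - (E i0 i0 / M i0 i0) *: M.
have -> : f E = f E' by rewrite linearB linearZ /= fM scaler0 subr0.
have symE' : E'^T = E' by rewrite linearB linearZ /= symE symM.
rewrite (sym_mx_sum_delta symE') -/S (big_setD1 _ S0) /= big_enum_val.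
rewrite {1}/E' !mxE divfK // subrr scale0r add0r linear_sum /=.
apply: summx_sub => s _; rewrite linearZ /=; apply: scalemx_sub.
by have <- : row s B = f (sym_delta (enum_val s)); [rewrite rowK | exact: row_sub].
Qed.

End SymmetricImage.

(** * Transmission as a ratio of entries, and positive definite matrices *)

Section TransmissionMatrix.
Context {R : realType} {n : nat}.
Implicit Types (A : 'M[R]_n) (mu nu : 'I_n).

Lemma transmissionE A mu nu : A \in unitmx -> invmx A mu mu != 0 ->
  transmission A nu mu = invmx A nu mu / invmx A mu mu.
Proof.
move=> uA C0; set v := (invmx A mu mu)^-1 *: col mu (invmx A).
have sv : transmission_state A mu v.
  split=> [|i ne]; first by rewrite !mxE mulVf.
  by rewrite -scalemxAr colE mulKVmx // !mxE (negbTE ne) mulr0.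
have [u [_ uU]] := (transmission_state_uniqueP mu uA).2 C0.
rewrite /transmission (xget_unique 0 (sv : [set _ | _]%classic v)).
  by rewrite !mxE mulrC.
by move=> y sy; rewrite -(uU _ sv) (uU _ sy).
Qed.

Lemma invmx_entryE A mu nu : A \in unitmx ->
  invmx A nu mu = (\det A)^-1 * (\adj A) nu mu.
Proof. by move=> uA; rewrite /invmx uA mxE. Qed.

(** The determinant cancels in the ratio. What remains is polynomial in the entries of [A], so no
    inverse has to be differentiated. *)
Lemma transmission_adjE A mu nu : A \in unitmx -> (\adj A) mu mu != 0 ->
  transmission A nu mu = (\adj A) nu mu / (\adj A) mu mu.
Proof.
move=> uA adj0; have det0 : \det A != 0 by rewrite -unitfE -unitmxE.
rewrite transmissionE ?invmx_entryE ?mulf_neq0 ?invr_eq0 //.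
by field; rewrite adj0 det0.
Qed.

Lemma posdefmx_inv A : A \in unitmx -> posdefmx A -> posdefmx (invmx A).
Proof.
move=> uA [symA posA]; have symC : (invmx A)^T = invmx A by rewrite trmx_inv symA.
split=> // v v0.
(* The substitution w = C v turns the form of C into that of A. *)
have -> : v^T *m invmx A *m v = (invmx A *m v)^T *m A *m (invmx A *m v).
  by rewrite trmx_mul symC -!mulmxA mulKVmx.
apply: posA; apply: contra_neq v0 => /(congr1 (mulmx A)).
by rewrite mulKVmx // mulmx0.
Qed.

Lemma posdefmx_diag A mu : posdefmx A -> 0 < A mu mu.
Proof.
move=> [_ /(_ (delta_mx mu 0))]; rewrite trmx_delta -rowE -colE !mxE; apply.
by apply/eqP => /matrixP /(_ mu 0); rewrite !mxE !eqxx => /eqP; rewrite oner_eq0.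
Qed.

Lemma posdefmx_minor2 A mu nu : posdefmx A -> mu != nu ->
  A nu mu ^+ 2 < A mu mu * A nu nu.
Proof.
move=> pdA ne; have dnu := posdefmx_diag nu pdA; have [symA posA] := pdA.
have symE : A mu nu = A nu mu by rewrite -[in LHS]symA mxE.
(* Chosen so that [A *m v] vanishes at [nu]; the form at [v] is then [A nu nu] times the principal 2
   x 2 minor. *)
pose v : 'cV[R]_n := A nu nu *: delta_mx mu 0 - A nu mu *: delta_mx nu 0.
have v0 : v != 0.
  apply/eqP => /matrixP /(_ mu 0); rewrite !mxE !eqxx (negbTE ne) mulr1 mulr0 subr0.
  by apply/eqP; rewrite gt_eqF.
have Av i : (A *m v) i 0 = A nu nu * A i mu - A nu mu * A i nu.
  by rewrite mulmxBr -!scalemxAr -!colE !mxE.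
have vT (w : 'cV[R]_n) :
    (v^T *m w) 0 0 = A nu nu * w mu 0 - A nu mu * w nu 0.
  have -> : v^T = A nu nu *: delta_mx 0 mu - A nu mu *: delta_mx 0 nu.
    by rewrite linearB !linearZ /= !trmx_delta.
  by rewrite mulmxBl -!scalemxAl -!rowE !mxE.
have := posA v v0; rewrite -mulmxA vT !Av symE.
rewrite [A nu mu * A nu nu]mulrC subrr mulr0 subr0 pmulr_rgt0 // subr_gt0.
by rewrite [A nu nu * _]mulrC -expr2.
Qed.

End TransmissionMatrix.

(** * Differentiability of determinants, adjugates and row vectors *)

Section DifferentiableMatrix.
Context {R : realType} {V : normedModType R}.
Implicit Types (x : V).
Local Open Scope classical_set_scope.

(** The first-order expansion of [f] is also one of [g], and uniqueness of the differential
    identifies the two. This carries smoothness over to the transmission, which is defined by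
    choice. *)
Lemma near_eq_differentiable {W : normedModType R} (f g : V -> W) x :
  (\forall y \near x, f y = g y) -> differentiable f x -> differentiable g x.
Proof.
move=> fg df; have fgx := nbhs_singleton fg.
have go : g \o shift x = cst (g x) + 'd f x +o_ 0 id.
  apply/eqaddoP => e e0; have /eqaddoP/(_ e e0) := diff_locally df.
  have : \forall h \near 0, f (h + x) = g (h + x).
    by have := fg; rewrite (near_shift 0); apply: filterS => h /=; rewrite subr0.
  by apply: filterS2 => h fgh; rewrite !fctE /= -fgh -fgx.
have dgE := diff_unique (diff_continuous df) go.
by apply/diff_locallyP; rewrite dgE; split=> //; exact: diff_continuous.
Qed.

Lemma differentiable_bigsum (I : Type) (r : seq I) (Q : pred I) (f : I -> V -> R) x :
  (forall i, differentiable (f i) x) ->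
  differentiable (fun y => \sum_(i <- r | Q i) f i y) x.
Proof.
move=> df; rewrite (_ : (fun y => _) = \sum_(i <- r | Q i) f i); last first.
  by apply/funext => y; rewrite fct_sumE.
by elim/big_ind: _ => // g h; exact: differentiableD.
Qed.

Lemma differentiable_bigprod (I : Type) (r : seq I) (Q : pred I) (f : I -> V -> R) x :
  (forall i, differentiable (f i) x) ->
  differentiable (fun y => \prod_(i <- r | Q i) f i y) x.
Proof.
move=> df; rewrite (_ : (fun y => _) = \prod_(i <- r | Q i) f i); last first.
  by apply/funext => y; rewrite fct_prodE.
by elim/big_ind: _ => // g h; exact: differentiableM.
Qed.

Lemma differentiable_det (n : nat) (A : V -> 'M[R]_n) x :
  (forall i j, differentiable (fun y => A y i j) x) ->
  differentiable (fun y => \det (A y)) x.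
Proof.
move=> dA; apply: differentiable_bigsum => s; apply: differentiableM.
  exact: differentiable_cst.
exact: differentiable_bigprod.
Qed.

Lemma differentiable_adj (n : nat) (A : V -> 'M[R]_n) x :
  (forall i j, differentiable (fun y => A y i j) x) ->
  forall i j, differentiable (fun y => (\adj (A y)) i j) x.
Proof.
move=> dA i j; under eq_fun do rewrite mxE.
apply: differentiableM; first exact: differentiable_cst.
apply: differentiable_det => u v; under eq_fun do rewrite !mxE.
exact: dA.
Qed.

Lemma differentiable_rV (q : nat) (f : V -> 'rV[R]_q) x :
  (forall s, differentiable (fun y => f y 0 s) x) -> differentiable f x.
Proof.
move=> df; rewrite (_ : f = \sum_(s < q) (fun y => f y 0 s *: delta_mx 0 s)).
  by apply: differentiable_sum => s; exact: differentiableZl.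
by apply/funext => y; rewrite fct_sumE [LHS]row_sum_delta.
Qed.

(** A coordinate is a continuous linear map, hence its own differential, and the chain rule applies.
    Jacobian entries thus become scalar directional derivatives. *)
Lemma diff_coord (q : nat) (f : V -> 'rV[R]_q) x v s :
  differentiable f x -> 'd f x v 0 s = 'D_v (fun y => f y 0 s) x.
Proof.
move=> df; pose c (w : 'rV[R]_q) : R := w 0 s.
have clin : linear c by move=> a u w; rewrite /c !mxE.
pose cM := GRing.isLinear.Build _ _ _ _ _ clin.
pose cL : {linear 'rV[R]_q -> R} := HB.pack c cM.
have cC : continuous cL by exact: coord_continuous.
have dcE : 'd c (f x) = c :> (_ -> _) by exact: (@diff_lin _ _ _ cL).
have dc : differentiable c (f x)  by exact: (@linear_differentiable _ _ _ cL).
rewrite (_ : (fun y => _) = c \o f) // deriveE; last exact: differentiable_comp.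
by rewrite (diff_comp df dc) /= dcE.
Qed.

Lemma differentiable_near_neq0 (f : V -> R) x : differentiable f x -> f x != 0 ->
  \forall y \near x, f y != 0.
Proof. by move=> /differentiable_continuous; exact: cvgr_neq0. Qed.

End DifferentiableMatrix.

(** * Derivative of the transmission along a family of matrices *)

Section TransmissionDifferential.
Context {R : realType} {n : nat} {V : normedModType R}.
Variables (A : V -> 'M[R]_n) (P : {set 'I_n}) (x : V).
Hypothesis dA : forall i j, differentiable (fun y => A y i j) x.
Hypothesis uA : A x \in unitmx.
Hypothesis C0 : forall mu, mu \in P -> invmx (A x) mu mu != 0.
Local Open Scope classical_set_scope.

Lemma near_unitmx : \forall y \near x, A y \in unitmx.
Proof.
have det0 : \det (A x) != 0 by rewrite -unitfE -unitmxE.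
have := differentiable_near_neq0 (differentiable_det dA) det0.
by apply: filterS => y; rewrite unitmxE unitfE.
Qed.

Lemma adj_diag_neq0 mu : mu \in P -> (\adj (A x)) mu mu != 0.
Proof. by move=> /C0; rewrite invmx_entryE // mulf_eq0 negb_or => /andP[]. Qed.

(** The determinant and the diagonal adjugate entry are continuous and nonzero at [x], so the ratio
    formula persists nearby. *)
Lemma near_transmissionE mu nu : mu \in P -> \forall y \near x,
  (\adj (A y)) mu mu != 0 /\
  transmission (A y) nu mu = (\adj (A y)) nu mu / (\adj (A y)) mu mu.
Proof.
move=> Pmu.
have := differentiable_near_neq0 (differentiable_adj dA mu mu) (adj_diag_neq0 Pmu).
by apply: filterS2 near_unitmx => y uy ay; split=> //; exact: transmission_adjE.
Qed.

Lemma differentiable_transmission mu nu : mu \in P ->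
  differentiable (fun y => transmission (A y) nu mu) x.
Proof.
move=> Pmu; apply: (@near_eq_differentiable _ _ _
    (fun y => (\adj (A y)) nu mu / (\adj (A y)) mu mu)).
  by apply: filterS (near_transmissionE nu Pmu) => y [].
apply: differentiableM; first exact: differentiable_adj.
by apply: differentiableV (adj_diag_neq0 Pmu); exact: differentiable_adj.
Qed.

Lemma differentiable_transmission_mx :
  differentiable (fun y => mxvec (transmission_mx (A y) P)) x.
Proof.
apply: differentiable_rV => s; case/mxvec_indexP: s => i j.
under eq_fun do rewrite mxvecE mxE.
exact: differentiable_transmission (enum_valP j).
Qed.

(** Leibniz on [D * a], which equals the adjugate entry near [x], solved for the derivative of [D].
    The result is linear in the derivative of the adjugate, with coefficients frozen at [x]. *)
Lemma derive_transmission mu nu v : mu \in P ->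
  'D_v (fun y => transmission (A y) nu mu) x =
  ('D_v (fun y => (\adj (A y)) nu mu) x
   - (\adj (A x)) nu mu / (\adj (A x)) mu mu
     * 'D_v (fun y => (\adj (A y)) mu mu) x) / (\adj (A x)) mu mu.
Proof.
move=> Pmu; have a0 := adj_diag_neq0 Pmu.
set D := fun y => transmission (A y) nu mu.
set a := fun y => (\adj (A y)) mu mu.
have -> : 'D_v (fun y => (\adj (A y)) nu mu) x = 'D_v (D * a) x.
  apply: near_eq_derive; apply: filterS (near_transmissionE nu Pmu) => y [ay Dy].
  by rewrite fctE /D Dy divfK.
rewrite deriveM; try (apply: diff_derivable).
- have -> : D x = (\adj (A x)) nu mu / (\adj (A x)) mu mu.
    by rewrite /D; have [] := nbhs_singleton (near_transmissionE nu Pmu).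
  rewrite /a /GRing.scale /=; field.
  exact: a0.
- exact: differentiable_transmission.
- exact: differentiable_adj.
Qed.

End TransmissionDifferential.

(** * Rank of the Jacobian for a symmetric family *)

Lemma rank_jacobian_transmission (R : realType) (m n : nat)
    (A : 'rV[R]_m -> 'M[R]_n) (P : {set 'I_n}) (x : 'rV[R]_m) :
  (forall i j, differentiable (fun y => A y i j) x) ->
  A x \in unitmx -> (forall mu, mu \in P -> invmx (A x) mu mu != 0) ->
  (forall y, (A y)^T = A y) -> (0 < #|P|)%N ->
  (\rank ('J (fun y => mxvec (transmission_mx (A y) P)) x) <= 'C(#|P|.+1, 2).-1)%N.
Proof.
move=> dA uA C0 symA P0.
pose e (i : 'I_#|P|) := enum_val i.
pose M := mxsub e e (\adj (A x)).
have ME i j : M i j = (\adj (A x)) (e i) (e j) by rewrite mxE.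
have M0 i : M i i != 0 by rewrite ME; exact: adj_diag_neq0 (enum_valP i).
(* The quotient rule, with an arbitrary [E] in place of the derivative of the adjugate. *)
pose f (E : 'M[R]_#|P|) : 'rV[R]_(#|P| * #|P|) :=
  mxvec (\matrix_(i, j) ((E i j - M i j / M j j * E j j) / M j j)).
have flin : linear f.
  move=> c E E'; rewrite -linearP /=; congr mxvec; apply/matrixP => i j.
  by move: M {ME M0} @f => M; rewrite !mxE; ring.
pose fM := GRing.isLinear.Build _ _ _ _ _ flin.
pose fL : {linear 'M[R]_#|P| -> 'rV[R]_(#|P| * #|P|)} := HB.pack f fM.
have sym_adj y : (\adj (A y))^T = \adj (A y) by rewrite trmx_adj symA.
apply: (@rank_sym_image _ _ _ _ fL M (Ordinal P0)) => //.
- by rewrite trmx_mxsub sym_adj.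
- rewrite -[RHS](linear0 mxvec); congr mxvec; apply/matrixP => i j.
  by rewrite mxE divfK // subrr mul0r mxE.
move=> b; pose v : 'rV[R]_m := delta_mx 0 b.
(* Symmetric because the adjugate is symmetric at every [y], not only at [x]. *)
exists (\matrix_(i, j) 'D_v (fun y => (\adj (A y)) (e i) (e j)) x).
  apply/matrixP => i j; rewrite !mxE; congr (derive _ _ _).
  by apply/funext => y; rewrite -[in LHS]sym_adj mxE.
(* Row [b] of the Jacobian is the differential at the basis vector [v]. *)
rewrite rowE mul_rV_lin1; apply/rowP => s; case/mxvec_indexP: s => i j.
rewrite diff_coord; last exact: differentiable_transmission_mx.
under eq_fun do rewrite mxvecE mxE.
rewrite (derive_transmission dA uA C0) ?enum_valP // mxvecE.
by rewrite [RHS]mxE !ME; congr ((_ - _ * _) / _); rewrite mxE.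
Qed.

(** * Dependence of the stiffness matrix on k *)

Section Stiffness.
Context {R : realType} {N nb : nat}.
Variable net : network R N nb.
Implicit Types k a : 'rV[R]_nb.

Lemma stiffness_entry k a i j : stiffness net k a i j =
  \sum_(b < nb) (k 0 b * qvec net b i 0 + a 0 b * svec net b i 0) * qvec net b j 0.
Proof.
rewrite summxE; apply: eq_bigr => b _.
by rewrite !mxE big_ord1 !mxE.
Qed.

(* The stiffnesses only enter through the symmetric matrices [q q^T], so the
   antisymmetric part of K is independent of k. *)
Lemma Kff_sym_eq k k' a : (Kff net k a)^T = Kff net k a ->
  (Kff net k' a)^T = Kff net k' a.
Proof.
move=> /matrixP symK; apply/matrixP => i j; have := symK i j.
rewrite !mxE !stiffness_entry => /eqP; rewrite -subr_eq0 -sumrB => /eqP e.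
apply/eqP; rewrite -subr_eq0 -sumrB -[X in _ == X]e; apply/eqP.
by apply: eq_bigr => b _; ring.
Qed.

Lemma differentiable_Kff k a i j : differentiable (fun k' => Kff net k' a i j) k.
Proof.
under eq_fun do rewrite mxE stiffness_entry.
apply: differentiable_bigsum => b; apply: differentiableM; last exact: differentiable_cst.
apply: differentiableD; last exact: differentiable_cst.
apply: differentiableM; last exact: differentiable_cst.
exact: differentiable_coord.
Qed.

End Stiffness.

Theorem theorem10 (R : realType) (N nb : nat) (net : network R N nb)
    (k a : 'rV[R]_nb) (hk : forall b, 0 < k 0 b)
    (hK : Kff net k a \in unitmx)
    (P : {set 'I_(nfree net)})
    (hP : forall mu, mu \in P -> invmx (Kff net k a) mu mu != 0) :
  let C := invmx (Kff net k a) in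
  let D := transmission (Kff net k a) in
  let p := #|P| in
  (forall mu nu, mu \in P -> nu \in P -> mu != nu ->
     D nu mu = C nu mu / C mu mu) /\
  (C = C^T ->
     (forall mu nu, mu \in P -> nu \in P ->
        D nu mu * C mu mu = D mu nu * C nu nu /\ D mu nu * C nu nu = C mu nu) /\
     (forall mu nu rho, mu \in P -> nu \in P -> rho \in P ->
        D nu mu * D rho nu * D mu rho = D mu nu * D nu rho * D rho mu /\
        D nu mu * D rho nu * D mu rho =
          C nu mu * C rho nu * C mu rho / (C mu mu * C nu nu * C rho rho) /\
        D mu nu * D nu rho * D rho mu =
          C nu mu * C rho nu * C mu rho / (C mu mu * C nu nu * C rho rho)) /\
     (passive net k a ->
        posdefmx C /\
        (forall mu, mu \in P -> 0 < C mu mu) /\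
        (forall mu nu, mu \in P -> nu \in P ->
           Num.sg (D nu mu) = Num.sg (D mu nu)) /\
        (forall mu nu, mu \in P -> nu \in P -> mu != nu ->
           D nu mu * D mu nu < 1))) /\
  (forall mu, mu \in P -> D mu mu = 1) /\
  ((2 <= p)%N ->
     (((p - 1) * (p + 2)) %/ 2 = p * (p - 1) - ((p - 1) * (p - 2)) %/ 2)%N /\
     (C = C^T ->
        differentiable (transmission_map P a) k /\
        (\rank ('J (transmission_map P a) k)
           <= minn nb (((p - 1) * (p + 2)) %/ 2))%N)).
Proof.
move=> C D p.
have DE mu nu : mu \in P -> D nu mu = C nu mu / C mu mu.
  by move=> /hP; exact: transmissionE.
have D1 mu : mu \in P -> D mu mu = 1 by move=> Pmu; rewrite DE // divff ?hP.
split; first by move=> mu nu Pmu _ _; exact: DE.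
split; last split=> //.
  move=> symC; have sC i j : C j i = C i j by rewrite {1}symC mxE.
  split; last split.
  - by move=> mu nu Pmu Pnu; rewrite !DE // !divfK ?hP.
  - move=> mu nu rho Pmu Pnu Prho; rewrite !DE //.
    have [C1 C2 C3] := And3 (hP _ Pmu) (hP _ Pnu) (hP _ Prho).
    (* Symmetry of C reverses the cycle in the numerator; the denominators already agree. *)
    have -> : C mu nu / C nu nu * (C nu rho / C rho rho) * (C rho mu / C mu mu)
        = C nu mu * C rho nu * C mu rho / (C mu mu * C nu nu * C rho rho).
      rewrite (sC nu mu) (sC rho nu) (sC mu rho); field.
      by rewrite C1 C2 C3.
    have -> : C nu mu / C mu mu * (C rho nu / C nu nu) * (C mu rho / C rho rho)
        = C nu mu * C rho nu * C mu rho / (C mu mu * C nu nu * C rho rho).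
      by field; rewrite C1 C2 C3.
    by [].
  - move=> [_ pdK]; have pdC := posdefmx_inv hK pdK.
    have dC mu : 0 < C mu mu by exact: posdefmx_diag.
    split=> //; split=> [mu _|]; first exact: dC.
    split=> [mu nu Pmu Pnu|mu nu Pmu Pnu ne]; rewrite !DE //.
      by rewrite !sgrM !sgrV !(gtr0_sg (dC _)) sC.
    (* The product is the squared off-diagonal entry over two diagonal ones, so the bound is
       positivity of a 2 x 2 minor of C. *)
    rewrite (sC nu mu) mulf_div ltr_pdivrMr ?mulr_gt0 // mul1r -expr2.
    exact: posdefmx_minor2.
move=> p2; have [binE gapE] := rank_ceilingE p2; split=> //.
move=> symC.
have symK : (Kff net k a)^T = Kff net k a.
  by rewrite -[Kff net k a]invmxK -/C {2}symC trmx_inv.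
have dK i j : differentiable (fun k' => Kff net k' a i j) k.
  exact: differentiable_Kff.
split; first exact: differentiable_transmission_mx.
(* One Jacobian row per bond gives the bound [nb]. *)
rewrite leq_min rank_leq_row binE.
apply: rank_jacobian_transmission => //; last exact: leq_trans p2.
by move=> k'; exact: Kff_sym_eq symK.
Qed.
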